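(* Let $\Delta:\mathbb{N}^{(2)}\rightarrow\mathbb{N}$ be a colouring of the edges of the complete graph on $\mathbb{N}$ whose image is infinite. Then at least one of the following holds: (i) $\mathcal{G}_{\Delta}=\mathbb{N}$, i.e. for every $m\in\mathbb{N}$ there is a set $X\subset\mathbb{N}$ that is exactly $m$-coloured; (ii) there exists an infinite subset of $\mathbb{N}$ that is rainbow coloured; (iii) there exists an infinite subset of $\mathbb{N}$ that is star coloured.
   Context: For a set $X$, $X^{(2)}$ denotes the set of unordered pairs of elements of $X$ (the edges of the complete graph on $X$). For $X\subset\mathbb{N}$, $\Delta(X^{(2)})$ is the set of colours appearing on edges with both endpoints in $X$. $X$ is (exactly) $m$-coloured if $|\Delta(X^{(2)})|=m$. $\mathcal{G}_{\Delta}=\{m\in\mathbb{N}: \exists X\subset\mathbb{N}\text{ with }X\text{ exactly }m\text{-coloured}\}$. $X$ is rainbow coloured if no two distinct edges with both endpoints in $X$ receive the same colour. $X$ is star coloured (with centre $v$) if there is $v\in X$ such that $X\setminus\{v\}$ is $1$-coloured and the edges between $v$ and $X\setminus\{v\}$ all have pairwise distinct colours, all different from the colour of $X\setminus\{v\}$. *)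

(* Defs.v *)
From mathcomp Require Import all_boot finmap.
From mathcomp Require Import boolp classical_sets functions cardinality.

Set Implicit Arguments.
Unset Strict Implicit.
Unset Printing Implicit Defensive.

Local Open Scope classical_set_scope.

Definition edge := {e : {fset nat} | #|` e| == 2}.

(* X^(2) is the set of unordered pairs of distinct elements of X; edge is nat^(2). *)
Definition edges (X : set nat) : set edge :=
  [set e | forall x : nat, x \in val e -> X x].

Definition edges_between (v : nat) (Y : set nat) : set edge :=
  [set e | exists2 y, Y y & val e = [fset v; y]%fset].

Definition colours (Delta : edge -> nat) (X : set nat) : set nat :=
  Delta @` edges X.

Definition exactly_coloured (Delta : edge -> nat) (m : nat) (X : set nat) :
  Prop := (colours Delta X #= `I_m)%card.

Definition G_ (Delta : edge -> nat) : set nat :=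
  [set m | exists X : set nat, exactly_coloured Delta m X].

Definition rainbow_coloured (Delta : edge -> nat) (X : set nat) : Prop :=
  forall e f, edges X e -> edges X f -> Delta e = Delta f -> e = f.

Definition star_coloured_at (Delta : edge -> nat) (v : nat) (X : set nat) :
  Prop :=
  [/\ X v,
      exactly_coloured Delta 1 (X `\ v),
      forall e f, edges_between v (X `\ v) e -> edges_between v (X `\ v) f ->
        Delta e = Delta f -> e = f
    & forall e, edges_between v (X `\ v) e ->
        ~ colours Delta (X `\ v) (Delta e)].

Definition star_coloured (Delta : edge -> nat) (X : set nat) : Prop :=
  exists v, star_coloured_at Delta v X.

(* Main.v *)
(** Fix a nonprincipal ultrafilter U on the naturals.

If some vertex v sees infinitely many colours, pick a sequence of neighbours
with distinct colours to v and apply the canonical Ramsey theorem to it: a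
monochromatic subsequence yields a star, and colourings by the minimum or the
maximum of an edge realise every m on finite sets. The canonical Ramsey theorem
itself is obtained by asking whether U-almost every vertex has a U-limit colour,
and then whether that limit (resp. the class of the vertex for U-almost
everywhere equality of colours) is U-almost constant.

Otherwise the colours at each vertex are bounded, and one greedily finds
disjoint edges a_i b_i whose colours c_i exceed all colours at earlier vertices.
The colours of a_i a_j, a_i b_j, b_i a_j, b_i b_j with i < j may be assumed, by
U-limits, to depend only on i. If one of these four is not U-almost constant,
every m is realised directly; if all are constant with t distinct values, then
k full pairs with four further vertices realise t + k, and the few m < t are
realised by triangles. *)

Require Import Defs.
From mathcomp Require Import all_boot finmap.
From mathcomp Require Import boolp classical_sets functions cardinality filter.
From mathcomp Require Import zify.

Set Implicit Arguments.
Unset Strict Implicit.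
Unset Printing Implicit Defensive.

Local Open Scope classical_set_scope.

(* The value on the diagonal x = y is the junk 0. *)
Definition pair_colour (Delta : edge -> nat) (x y : nat) : nat :=
  if insub [fset x; y]%fset is Some e then Delta e else 0.

Lemma pair_colourC Delta x y : pair_colour Delta x y = pair_colour Delta y x.
Proof. by rewrite /pair_colour fsetUC. Qed.

Lemma pair_colourE Delta (e : edge) x y :
  val e = [fset x; y]%fset -> Delta e = pair_colour Delta x y.
Proof. by move=> exy; rewrite /pair_colour -exy valK. Qed.

Lemma edge_of x y : x != y -> exists e : edge, val e = [fset x; y]%fset.
Proof.
move=> xy; have c2 : #|` [fset x; y]%fset| == 2 by rewrite cardfs2 xy.
by exists (Sub [fset x; y]%fset c2).
Qed.

Lemma edgeP (e : edge) : exists x y, x != y /\ val e = [fset x; y]%fset.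
Proof.
have /eqP e2 := valP e.
have [x xe] : exists x, x \in val e.
  by apply/fset0Pn; rewrite -cardfs_gt0 e2.
have /cardfs1P[y exy] : #|` val e `\ x|%fset == 1.
  by move: e2; rewrite (cardfsD1 x) xe => -[/eqP].
have : y \in (val e `\ x)%fset by rewrite exy fset11.
rewrite !inE => /andP[yx _]; exists x, y; rewrite eq_sym yx -exy.
by split => //; rewrite fsetD1K.
Qed.

(** All colour counts go through this form: a duplicate-free list turns a cardinality of a set of
    colours into membership checks on pairs of vertices. *)
Lemma exactly_coloured_seq Delta (X : set nat) (l : seq nat) :
    uniq l ->
    (forall x y, X x -> X y -> x != y -> pair_colour Delta x y \in l) ->
    (forall c, c \in l ->
      exists x y, [/\ X x, X y, x != y & pair_colour Delta x y = c]) ->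
  exactly_coloured Delta (size l) X.
Proof.
move=> ul Xl lX; rewrite /exactly_coloured.
have -> : colours Delta X = [set` [fset c in l]%fset].
  apply/seteqP; split=> [c [e eX <-]|c] /=.
    have [x [y [xy exy]]] := edgeP e.
    rewrite (pair_colourE Delta exy) inE Xl //; apply: eX; rewrite exy.
      exact: fset21.
    exact: fset22.
  rewrite inE => /lX[x [y [Xx Xy /edge_of[e exy] <-]]].
  exists e; last exact: pair_colourE.
  by move=> z; rewrite exy => /fset2P[] ->.
by apply/card_eq_fsetP; rewrite card_fseq undup_id.
Qed.

(** * Ultrafilters on the naturals and diagonal sequences *)

Section Ultra.
Variables (U : set_system nat) (UU : UltraFilter U).
Hypothesis U_oo : eventually `<=` U.

Lemma ultra_gt n : U [set m | n < m].
Proof. by apply: U_oo; exists n.+1. Qed.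

Lemma ultra_nonempty A : U A -> exists x, A x.
Proof. by move=> /filter_ex[x Ax]; exists x. Qed.

Lemma ultra_all (T : eqType) (s : seq T) (R : T -> set nat) :
  (forall x, x \in s -> U (R x)) -> U [set y | forall x, x \in s -> R x y].
Proof.
elim: s => [|x s IH] sR; first by apply: filterS filterT => y _ x /=.
have UR : U [set y | forall x, x \in s -> R x y].
  by apply: IH => z zs; apply: sR; rewrite inE zs orbT.
apply: filterS2 (sR x (mem_head x s)) UR => y Rxy Rsy z.
by rewrite inE => /predU1P[->//|]; exact: Rsy.
Qed.

Lemma ultra_bounded (f : nat -> nat) N :
  U [set y | f y <= N] -> exists c, U [set y | f y = c].
Proof.
elim: N => [|N IH] UN.
  by exists 0; apply: filterS UN => y /=; rewrite leqn0 => /eqP.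
have [UN1|UN1] := in_ultra_setVsetC [set y | f y = N.+1] UU.
  by exists N.+1.
apply: IH; apply: filterS2 UN UN1 => y /= le_yN ne_yN.
by rewrite -ltnS ltn_neqAle le_yN andbT; apply/eqP.
Qed.

(** Finite intersections of sets of [U] are nonempty, so each term can meet all constraints set by
    earlier ones. [R] takes three earlier terms so that a new edge can be compared with any earlier
    edge. *)
Lemma ultra_sequence (W : set nat) (R : nat -> nat -> nat -> set nat) :
    U W ->
    (forall x y z, W x -> W y -> W z -> U (R x y z)) ->
  exists phi : nat -> nat,
    [/\ forall n, W (phi n),
        forall i j, i < j -> phi i < phi j
      & forall i j k n, i < n -> j < n -> k < n ->
          R (phi i) (phi j) (phi k) (phi n)].
Proof.
move=> UW UR.
(* The condition on [s] sits under the existential so that [choice] gives a function on all lists,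
   with default 0. *)
have next (s : seq nat) : exists y, (forall x, x \in s -> W x) ->
    [/\ W y, (forall x, x \in s -> x < y)
      & forall x x' x'', x \in s -> x' \in s -> x'' \in s -> R x x' x'' y].
  have [sW|nW] := pselect (forall x, x \in s -> W x); last by exists 0.
  have [|y [Wy [Gy Ry]]] := @ultra_nonempty
    (W `&` ([set y | forall x, x \in s -> x < y] `&`
      [set y | forall x, x \in s -> forall x', x' \in s ->
           forall x'', x'' \in s -> R x x' x'' y])).
    apply: filterI => //; apply: filterI.
      by apply: ultra_all => x _; apply: ultra_gt.
    apply: ultra_all => x xs; apply: ultra_all => x' x's.
    apply: ultra_all => x'' x''s.
    by apply: UR; exact: sW.
  exists y => _; split => // x x' x'' xs x's x''s; exact: Ry.
have [h hP] := choice next.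
pose pre := fix pre n :=
  if n is n'.+1 then rcons (pre n') (h (pre n')) else [::].
have preW n : forall x, x \in pre n -> W x.
  elim: n => [//|n IH] x; rewrite /= mem_rcons inE => /predU1P[->|/IH//].
  by have [] := hP _ IH.
have pre_in i n : i < n -> h (pre i) \in pre n.
  elim: n => [//|n IH]; rewrite ltnS leq_eqVlt /= mem_rcons inE.
  by case/predU1P=> [->|/IH ->]; rewrite ?eqxx ?orbT.
exists (fun n => h (pre n)); split.
- by move=> n; have [] := hP _ (@preW n).
- by move=> i j ij; have [_ + _] := hP _ (@preW j); apply; apply: pre_in.
- move=> i j k n i_n j_n k_n; have [_ _] := hP _ (@preW n).
  by apply; apply: pre_in.
Qed.
End Ultra.

Lemma exists_ultra_oo :
  exists U : set_system nat, UltraFilter U /\ eventually `<=` U.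
Proof. exact: ultraFilterLemma. Qed.

(** * Pairwise relations on lists and infinite ranges *)

Lemma pairwise_in (T : eqType) (r : rel T) (s : seq T) x y :
  symmetric r -> pairwise r s -> x \in s -> y \in s -> x != y -> r x y.
Proof.
move=> r_sym; elim: s => //= z s IH /andP[/allP zs rs].
rewrite !inE => /predU1P[->|xs] /predU1P[->|ys]; rewrite ?eqxx //.
- by move=> _; apply: zs.
- by move=> _; rewrite r_sym; apply: zs.
- exact: IH.
Qed.

Lemma pairwise_iota (r : rel nat) m n :
  (forall i j, m <= i -> i < j -> j < m + n -> r i j) -> pairwise r (iota m n).
Proof.
elim: n m => //= n IH m rP; apply/andP; split.
  by apply/allP => j; rewrite mem_iota => /andP[mj jn]; apply: rP; lia.
by apply: IH => i j mi ij jn; apply: rP; lia.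
Qed.

Lemma infinite_range (x : nat -> nat) :
  (forall i j, i < j -> x i != x j) -> infinite_set (range x).
Proof.
move=> x_inj; have inj : injective x.
  by move=> i j xij; case: (ltngtP i j) => // /x_inj; rewrite xij eqxx.
have /card_eqPle[_ le_range] :=
  inj_card_eq (in2W inj : {in setT &, injective x}).
exact/infiniteP.
Qed.

(** * Colour counts, stars and rainbows read off from sequences *)

Section Colouring.
Variable Delta : edge -> nat.
Local Notation d := (pair_colour Delta).

Lemma G_seq (s l : seq nat) :
    uniq l -> pairwise (fun x y => d x y \in l) s ->
    (forall c, c \in l ->
      exists x y, [/\ x \in s, y \in s, x != y & d x y = c]) ->
  G_ Delta (size l).
Proof.
move=> ul sl ls; exists [set` s]; apply: exactly_coloured_seq => // x y xs ys.
by apply: pairwise_in sl xs ys => {}x {}y; rewrite pair_colourC.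
Qed.

Lemma G_0 : G_ Delta 0.
Proof. exact: (@G_seq [::] [::]). Qed.

Lemma G_1 : G_ Delta 1.
Proof.
apply: (@G_seq [:: 0; 1] [:: d 0 1]) => //=; first by rewrite inE eqxx.
by move=> c; rewrite inE => /eqP->; exists 0, 1.
Qed.

(** The first [m + 1] vertices show exactly [h 0], ..., [h (m - 1)]. Bounding the indices by [m]
    admits finite sequences listed backwards. *)
Lemma G_lexical m (x h : nat -> nat) :
    (forall i j, i < j -> j <= m -> x i != x j /\ d (x i) (x j) = h i) ->
    (forall i j, i < j -> j < m -> h i != h j) ->
  G_ Delta m.
Proof.
move=> xP hP.
have <- : size (map h (iota 0 m)) = m by rewrite size_map size_iota.
apply: (@G_seq (map x (iota 0 m.+1))).
- rewrite uniq_pairwise pairwise_map.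
  by apply: pairwise_iota => i j _ ij jm; apply: hP.
- rewrite pairwise_map; apply: pairwise_iota => i j _ ij jm /=.
  by rewrite (xP i j _ _).2 // map_f // mem_iota; lia.
- move=> c /mapP[i]; rewrite mem_iota => /andP[_ im] ->.
  have [] := xP i i.+1 (ltnSn i) im.
  by exists (x i), (x i.+1); split; rewrite ?map_f // mem_iota; lia.
Qed.

(** Every [x] used precedes every [y] used, so edges from an earlier [y] to a later [x] may have
    arbitrary colours. *)
Lemma G_bipartite (x y h : nat -> nat) p s :
    (forall i j, i < j -> [/\ x i != x j, x i != y j & y i != y j]) ->
    (forall i j, i < j ->
      [/\ d (x i) (x j) = p, d (x i) (y j) = h i & d (y i) (y j) = s]) ->
    (forall i, h i != p /\ h i != s) ->
    (forall i j, i < j -> h i != h j) ->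
  G_ Delta = setT.
Proof.
move=> neP dP hps hP.
apply/seteqP; split => // -[|[|[|m]]] _; [exact: G_0|exact: G_1| |].
  (* Two colours need their own triangle: before a single [y], one [x] shows one colour and two
     already show three. *)
  have [[n1 n2 n3] [d1 d2 d3]] := (neP 1 2 isT, dP 1 2 isT).
  have [[m1 m2 m3] [e1 e2 e3]] := (neP 0 1 isT, dP 0 1 isT).
  have [[k1 k2 k3] [f1 f2 f3]] := (neP 0 2 isT, dP 0 2 isT).
  apply: (@G_seq [:: x 0; y 1; y 2] [:: h 0; s]) => /=.
  - by rewrite inE (hps 0).2.
  - by rewrite !inE e2 f2 d3 !eqxx ?orbT.
  - move=> c; rewrite !inE => /orP[]/eqP->;
    [exists (x 0), (y 1)|exists (y 1), (y 2)];
    by split => //; rewrite !inE eqxx ?orbT.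
move EI : (iota 0 m.+2) => I.
have I_mem i : (i \in I) = (i < m.+2) by rewrite -EI mem_iota add0n.
have <- : size (p :: map h I) = m.+3 by rewrite /= size_map -EI size_iota.
apply: (@G_seq (rcons (map x I) (y m.+2))).
- rewrite cons_uniq; apply/andP; split.
    by apply/negP => /mapP[i _ /eqP]; rewrite eq_sym (negPf (hps i).1).
  rewrite uniq_pairwise pairwise_map -EI.
  by apply: pairwise_iota => i j _ ij _; apply: hP.
- rewrite pairwise_rcons all_map pairwise_map; apply/andP; split.
    apply/allP => i i_I /=; have [_ -> _] := dP i m.+2 ltac:(by rewrite -I_mem).
    by rewrite in_cons map_f ?orbT.
  rewrite -{2}EI; apply: pairwise_iota => i j _ ij jm /=.
  by have [-> _ _] := dP i j ij; rewrite mem_head.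
- move=> c; rewrite in_cons => /predU1P[->|/mapP[i i_I ->]].
    have [[n1 n2 n3] [d1 d2 d3]] := (neP 0 1 isT, dP 0 1 isT).
    by exists (x 0), (x 1); split;
      rewrite // mem_rcons in_cons map_f ?orbT ?I_mem.
  have im : i < m.+2 by rewrite -I_mem.
  have [[n1 n2 n3] [d1 d2 d3]] := (neP i m.+2 im, dP i m.+2 im).
  by exists (x i), (y m.+2); split;
    rewrite // mem_rcons in_cons ?eqxx // map_f ?orbT.
Qed.

(** Increasing spoke colours are distinct, and lying above [c] separates them from the colour of the
    leaves. *)
Lemma star_of_sequence v c (b : nat -> nat) :
    (forall n, v != b n) ->
    (forall i j, i < j -> d v (b i) < d v (b j)) ->
    (forall n, c < d v (b n)) ->
    (forall i j, i < j -> d (b i) (b j) = c) ->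
  exists X : set nat, infinite_set X /\ star_coloured Delta X.
Proof.
move=> vb incr cb mono.
have b_inj i j : i < j -> b i != b j.
  by move=> /incr; apply: contraTneq => ->; rewrite ltnn.
have Xv : (v |` range b) `\ v = range b.
  apply/seteqP; split=> [x [[->|//] nv]|_ [n _ <-]]; first by case: nv.
  by split; [right; exists n|move=> /= vbn; have := vb n; rewrite vbn eqxx].
have pairs x y : range b x -> range b y -> x != y -> d x y = c.
  move=> [i _ <-] [j _ <-].
  case: (ltngtP i j) => [ij _|ji _|->]; last by rewrite eqxx.
    exact: mono.
  by rewrite pair_colourC mono.
exists (v |` range b); split.
  by apply: (sub_infinite_set (@subsetUr _ _ _)); apply: infinite_range.
have one : exactly_coloured Delta 1 (range b).
  apply: (@exactly_coloured_seq _ _ [:: c]) => //.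
    by move=> x y bx byy xy; rewrite inE (pairs x y).
  move=> _ /[1!inE] /eqP ->; exists (b 0), (b 1).
  by split; [exists 0|exists 1|exact: b_inj|exact: mono].
exists v; split; rewrite ?Xv //; first by left.
- move=> e f [_ [i _ <-] ei] [_ [j _ <-] fj].
  rewrite (pair_colourE Delta ei) (pair_colourE Delta fj).
  case: (ltngtP i j) => [/incr|/incr|ij]; try lia.
  by move=> _; apply: val_inj; rewrite ei fj ij.
- move=> e [_ [i _ <-] ei] [f fX]; rewrite (pair_colourE Delta ei).
  have [x [y [xy fxy]]] := edgeP f.
  rewrite (pair_colourE Delta fxy) pairs //.
    by move=> cE; have := cb i; lia.
    by apply: fX; rewrite fxy fset21.
  by apply: fX; rewrite fxy fset22.
Qed.

Lemma rainbow_of_sequence (x : nat -> nat) :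
    (forall i j, i < j -> x i != x j) ->
    (forall i j k l, i < j -> k < l -> d (x i) (x j) = d (x k) (x l) ->
      i = k /\ j = l) ->
  rainbow_coloured Delta (range x).
Proof.
move=> x_inj dP.
have edge_x (e : edge) : edges (range x) e ->
    exists i j, i < j /\ val e = [fset x i; x j]%fset.
  have [u [w [uw euw]]] := edgeP e => eX.
  have [i _ xi] : range x u by apply: eX; rewrite euw fset21.
  have [j _ xj] : range x w by apply: eX; rewrite euw fset22.
  subst u w; case: (ltngtP i j) => [ij|ji|ij].
  - by exists i, j.
  - by exists j, i; rewrite fsetUC.
  - by rewrite ij eqxx in uw.
move=> e f /edge_x[i [j [ij eij]]] /edge_x[k [l [kl fkl]]].
rewrite (pair_colourE Delta eij) (pair_colourE Delta fkl).
move=> /(dP _ _ _ _ ij kl)[ik jl].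
by apply: val_inj; rewrite eij fkl ik jl.
Qed.

(** * Canonical Ramsey theorem by ultrafilter limits *)

Lemma canonical_sequence (a : nat -> nat) :
    (forall i j, i < j -> a i != a j) ->
  [\/ G_ Delta = setT,
      exists X : set nat, infinite_set X /\ rainbow_coloured Delta X
    | exists (phi : nat -> nat) (c : nat),
        (forall i j, i < j -> phi i < phi j) /\
        forall i j, i < j -> d (a (phi i)) (a (phi j)) = c].
Proof.
move=> a_inj; have [U [UU Uoo]] := exists_ultra_oo.
pose C : set nat := [set i | exists c, U [set j | d (a i) (a j) = c]].
have not_U A : ~ U A -> U (~` A) by have [] := in_ultra_setVsetC A UU.
have [UC|UC] := in_ultra_setVsetC C UU.
  have [i|f fP] := @choice _ _
    (fun i c => C i -> U [set j | d (a i) (a j) = c]).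
    by have [[c Uc]|nC] := pselect (C i); [exists c|exists 0].
  have [[c Uc]|nc] := pselect (exists c, U [set i | f i = c]).
    have [|x y z [Cx _] _ _|phi [phiW incr phiR]] := @ultra_sequence U UU Uoo
      (C `&` [set i | f i = c]) (fun x _ _ => [set n | d (a x) (a n) = f x]).
    - exact: filterI.
    - exact: fP.
    apply: Or33; exists phi, c; split => // i j ij.
    by rewrite (phiR i i i j) //; have [] := phiW i.
  (* No limit colour is shared by [U]-almost all indices, so each new term can be given a limit
     different from all earlier ones. *)
  have [||phi [phiW incr phiR]] := @ultra_sequence U UU Uoo C
      (fun x _ _ => [set n | d (a x) (a n) = f x] `&`
                    ~` [set n | f n = f x]) => //.
    move=> x _ _ Cx _ _; apply: filterI; first exact: fP.
    by apply: not_U => Ux; apply: nc; exists (f x).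
  apply: Or31; apply/seteqP; split=> // m _.
  apply: (@G_lexical m (a \o phi) (f \o phi)) => i j ij _ /=.
    by split; [apply: a_inj; exact: incr|have [] := phiR i i i j ij ij ij].
  by have [_ /eqP] := phiR i i i j ij ij ij; rewrite eq_sym.
have avoid x c : (~` C) x -> U [set n | d (a x) (a n) <> c].
  by move=> Cx; apply: not_U => Uc; apply: Cx; exists c.
(* Classes are encoded as sets, so that equivalence of indices becomes an equality. *)
pose cls x : set nat := [set y | U [set n | d (a x) (a n) = d (a y) (a n)]].
have clsP x y : U [set n | d (a x) (a n) = d (a y) (a n)] <-> cls x = cls y.
  split=> [Uxy|xy].
    apply/seteqP; split=> z /=; apply: filterS2 Uxy => n /=; congruence.
  have : cls y y by apply: filterS filterT.
  by rewrite -xy.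
have [[S US]|nS] := pselect (exists S, U [set i | cls i = S]).
  (* Inside one class all edges to a later term can be made to agree; the second constraint makes
     their common colour new. *)
  have [|x y z [Cx /= xS] [_ /= yS] _|phi [phiW incr phiR]] :=
    @ultra_sequence U UU Uoo (~` C `&` [set i | cls i = S])
    (fun x y z => [set n | d (a x) (a n) = d (a y) (a n)] `&`
                  [set n | d (a x) (a n) <> d (a y) (a z)]).
  - exact: filterI.
  - by apply: filterI; [apply/clsP; rewrite xS yS|exact: avoid].
  apply: Or31; apply/seteqP; split=> // m _.
  (* Counting down from [m] turns dependence on the larger index into dependence on the first one;
     [phi 0] is the reference vertex. *)
  apply: (@G_lexical m (fun i => a (phi (m - i)))
    (fun i => d (a (phi 0)) (a (phi (m - i))))) => i j ij jm.
    have ij' : m - j < m - i by lia.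
    rewrite pair_colourC eq_sym; split; first by apply: a_inj; exact: incr.
    by have [] := phiR (m - j) 0 0 (m - i) ij' ltac:(lia) ltac:(lia).
  by have [_ /eqP] := phiR 0 0 (m - j) (m - i) ltac:(lia) ltac:(lia) ltac:(lia).
have [|x y z Cx Cy _|phi [phiW incr phiR]] := @ultra_sequence U UU Uoo (~` C)
  (fun x y z => ~` [set n | cls n = cls x] `&`
                ([set n | cls x <> cls y -> d (a x) (a n) <> d (a y) (a n)] `&`
                [set n | d (a x) (a n) <> d (a y) (a z)])) => //.
  apply: filterI; first by apply: not_U => Ux; apply: nS; exists (cls x).
  apply: filterI; last exact: avoid.
  have [xy|xy] := pselect (cls x = cls y).
    by apply: filterS filterT => n _ /(_ xy).
  have : ~ U [set n | d (a x) (a n) = d (a y) (a n)] by move=> /clsP.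
  by move/not_U; apply: filterS => n /= nxy _.
apply: Or32; exists (range (a \o phi)); split.
  by apply: infinite_range => i j ij; apply: a_inj; apply: incr.
apply: rainbow_of_sequence => [i j ij|i j k l ij kl /= dE].
  by apply: a_inj; exact: incr.
(* Edges at a new term avoid all earlier colours, so equal colours force equal larger ends;
   inequivalence of the terms then settles the smaller ends. *)
have jl : j = l.
  case: (ltngtP j l) => // [jl|lj].
    by have [_ [_ /=]] := phiR k i j l kl ltac:(lia) jl; rewrite dE.
  by have [_ [_ /=]] := phiR i k l j ij ltac:(lia) lj; rewrite dE.
subst l; split => //.
have [_ [+ _]] := phiR i k k j ij kl kl.
case: (ltngtP i k) => // [ik|ki] ne.
  have [/= nik _] := phiR i i i k ik ik ik.
  by case: (ne (fun ikE => nik (esym ikE))).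
have [/= nki _] := phiR k k k i ki ki ki.
by case: (ne nki).
Qed.

(** * Matchings with constant colours across *)

Lemma G_matching (V : bool -> nat -> nat) (L : bool -> bool -> nat)
    (c : nat -> nat) :
    (forall b b' i j, i < j ->
      V b i != V b' j /\ d (V b i) (V b' j) = L b b') ->
    (forall i, V true i != V false i /\ d (V true i) (V false i) = c i) ->
    (forall b b' i, L b b' < c i) ->
    (forall i j, i < j -> c i < c j) ->
  G_ Delta = setT.
Proof.
move=> VL Vc Lc c_incr; apply/seteqP; split=> // m _.
pose ls := [:: L true true; L true false; L false true; L false false].
have Lls b b' : L b b' \in undup ls.
  by rewrite mem_undup; case: b; case: b'; rewrite !inE eqxx ?orbT.
have lsL e : e \in undup ls -> exists b b', e = L b b'.
  rewrite mem_undup !inE => /or4P[]/eqP->;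
  by [exists true, true|exists true, false|
      exists false, true|exists false, false].
have [le_m|lt_m] := leqP (size (undup ls)) m.
  (* Each full pair adds exactly one colour [c i] to the cross colours. *)
  pose k := m - size (undup ls).
  move EI : (iota 0 k) => I.
  have I_mem i : (i \in I) = (i < k) by rewrite -EI mem_iota add0n.
  have <- : size (undup ls ++ map c I) = m.
    by rewrite size_cat size_map -EI size_iota /k subnKC.
  pose v (u : nat * bool) := V u.2 u.1.
  (* The pattern a b b a contains each of the four ordered types of pairs. *)
  pose tail := [:: (k, true); (k.+1, false); (k.+2, false); (k.+3, true)].
  pose codes := [seq (i, true) | i <- I] ++ [seq (i, false) | i <- I] ++ tail.
  have codesP u : u \in codes -> u.1 < k \/ u \in tail.
    rewrite !mem_cat => /or3P[/mapP[i + ->]|/mapP[i + ->]|];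
      rewrite ?I_mem; by [left|right].
  have codes_full i b : i < k -> (i, b) \in codes.
    rewrite -I_mem !mem_cat => iI; case: b.
      by rewrite (map_f (fun i => (i, true))).
    by rewrite (map_f (fun i => (i, false))) ?orbT.
  have codes_tail u : u \in tail -> u \in codes.
    by rewrite !mem_cat => ->; rewrite !orbT.
  (* Tail indices are all different, so the tail contains no matching edge and adds no colour
     [c i]. *)
  have tail_inj u w : u \in tail -> w \in tail -> u.1 = w.1 -> u = w.
    by rewrite !inE => /or4P[]/eqP-> /or4P[]/eqP-> //=; lia.
  have d_codes u w : u \in codes -> w \in codes -> u != w ->
      d (v u) (v w) \in undup ls ++ map c I.
    case: u w => [i b] [j b'] /codesP iP /codesP jP neq; rewrite /v /= mem_cat.
    case: (ltngtP i j) => [ij|ji|ij].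
    - by rewrite (VL _ _ _ _ ij).2 Lls.
    - by rewrite pair_colourC (VL _ _ _ _ ji).2 Lls.
    subst j; have ik : i < k.
      case: iP jP => [//|iT] [//|jT].
      by have E := tail_inj _ _ iT jT erefl; rewrite E eqxx in neq.
    have cI : c i \in map c I by rewrite map_f ?I_mem.
    have [_ dc] := Vc i.
    rewrite (_ : d _ _ = c i) ?cI ?orbT // -dc.
    by case: b b' neq {iP jP} => [] [] //; rewrite ?eqxx // pair_colourC.
  exists [set` map v codes]; apply: exactly_coloured_seq.
  - rewrite cat_uniq undup_uniq; apply/and3P; split => //.
      apply/hasPn => _ /mapP[i _ ->]; apply/negP => /lsL[b [b' cE]].
      by have := Lc b b' i; rewrite -cE ltnn.
    rewrite uniq_pairwise pairwise_map -EI.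
    apply: pairwise_iota => i j _ ij _ /=.
    by have := c_incr _ _ ij; lia.
  - move=> x y /mapP[u uC ->] /mapP[w wC ->] ne; apply: d_codes => //.
    by apply: contraNneq ne => ->.
  - move=> e; rewrite mem_cat => /orP[/lsL[b [b' ->]]|/mapP[i + ->]]; last first.
      rewrite I_mem => ik; have [ne dc] := Vc i.
      by exists (V true i), (V false i); split=> //;
        [apply: (map_f v (codes_full i true ik))|
         apply: (map_f v (codes_full i false ik))].
    have [u [w [uT wT uw <- <-]]] : exists u w,
        [/\ u \in tail, w \in tail, u.1 < w.1, u.2 = b & w.2 = b'].
      case: b b' => [] [];
        [exists (k, true), (k.+3, true)|exists (k, true), (k.+1, false)|
         exists (k.+1, false), (k.+3, true)|exists (k.+1, false), (k.+2, false)];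
        by split => //=; rewrite ?inE ?eqxx ?orbT //; lia.
    exists (v u), (v w); have [ne dL] := VL u.2 w.2 _ _ uw.
    by split=> //; apply: map_f; apply: codes_tail.
have size_ls : size (undup ls) <= 4 by exact: size_undup.
case: m lt_m => [|[|[|[|m]]]] lt_m; [exact: G_0|exact: G_1| | |lia].
  have ex2 b b1 b2 :
      L b b1 != L b1 b2 -> L b b2 \in [:: L b b1; L b1 b2] -> G_ Delta 2.
    move=> neq Lin; have [n01 d01] := VL b b1 0 1 isT.
    have [n12 d12] := VL b1 b2 1 2 isT; have [_ d02] := VL b b2 0 2 isT.
    apply: (@G_seq [:: V b 0; V b1 1; V b2 2] [:: L b b1; L b1 b2]).
    - by rewrite /= inE neq.
    - by rewrite /= d01 d02 d12 Lin !inE !eqxx ?orbT.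
    - move=> e; rewrite !inE => /orP[]/eqP->;
      [exists (V b 0), (V b1 1)|exists (V b1 1), (V b2 2)];
      by split => //; rewrite !inE eqxx ?orbT.
  (* If none of the three triangles tried has two colours, all four values of [L] agree, against
     there being more than two. *)
  have [Lt|/ex2] := eqVneq (L true true) (L true false); last first.
    by apply; rewrite !inE eqxx ?orbT.
  have [Lf|/ex2] := eqVneq (L false false) (L false true); last first.
    by apply; rewrite !inE eqxx ?orbT.
  have [Lft|/ex2] := eqVneq (L false true) (L true true); last first.
    by apply; rewrite !inE eqxx ?orbT.
  by move: lt_m; rewrite /ls -Lt Lf Lft /= !inE eqxx.
(* More than three cross colours means that all four are distinct; a matching edge and a third
   vertex then show [c 0] and two of them. *)
have uls : uniq ls.
  by rewrite -[uniq ls]negbK -ltn_size_undup -leqNgt.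
have [n00 d00] := Vc 0; have [n01 d01] := VL true true 0 1 isT.
have [n01' d01'] := VL false true 0 1 isT.
apply: (@G_seq [:: V true 0; V false 0; V true 1]
  [:: c 0; L true true; L false true]).
- move: uls; rewrite /= !inE !negb_or => /and4P[/and3P[_ n _] _ _ _].
  by rewrite n andbT; have := (Lc true true 0, Lc false true 0) => -[]; lia.
- by rewrite /= d00 d01 d01' !inE !eqxx ?orbT.
- move=> e; rewrite !inE => /or3P[]/eqP->;
  [exists (V true 0), (V false 0)|exists (V true 0), (V true 1)|
   exists (V false 0), (V true 1)];
  by split => //; rewrite !inE eqxx ?orbT.
Qed.

(** * Locally bounded colourings *)

Lemma G_locally_bounded (M : nat -> nat) :
    (forall x y, x != y -> d x y <= M x) ->
    (forall N, exists x y, x != y /\ N < d x y) ->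
  G_ Delta = setT.
Proof.
move=> dM unb.
have [N|h hP] := @choice _ _ (fun N e => e.1 != e.2 /\ N < d e.1 e.2).
  by have [x [y xy]] := unb N; exists (x, y).
(* [K n] bounds [M] on the vertices of all pairs before the [n]-th, whose own colour is chosen above
   [K n]. *)
pose K := fix K n := if n is n'.+1 then
  maxn (K n') (maxn (M (h (K n')).1) (M (h (K n')).2)) else 0.
pose V (b : bool) n := if b then (h (K n)).1 else (h (K n)).2.
pose c n := d (V true n) (V false n).
have K_incr i j : i <= j -> K i <= K j.
  elim: j => [|j IH]; first by rewrite leqn0 => /eqP->.
  by rewrite leq_eqVlt => /predU1P[->//|/IH ij]; rewrite /= leq_max ij.
have MK b i j : i < j -> M (V b i) <= K j.
  by move=> /K_incr; apply: leq_trans; rewrite /V; case: b => /=; lia.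
have cK n : K n < c n by have [] := hP (K n).
have V_neq n : V true n != V false n by have [] := hP (K n).
have cM b n : c n <= M (V b n).
  by case: b; [exact: dM|rewrite /c pair_colourC; apply: dM; rewrite eq_sym].
(* Disjointness is automatic: a vertex reused in pair [j] would give
   [c j <= M (V b i) <= K j < c j]. *)
have VV b b' i j : i < j -> V b i != V b' j.
  move=> ij; apply/eqP => E; have := MK b i j ij.
  by have := (cM b' j, cK j) => -[]; rewrite E; lia.
have dVK b b' i j : i < j -> d (V b i) (V b' j) <= K j.
  by move=> ij; apply: leq_trans (dM _ _ (VV b b' i j ij)) (MK _ _ _ ij).
have c_incr i j : i < j -> c i < c j.
  by move=> ij; have := (cM true i, MK true i j ij, cK j) => -[[]]; lia.
have [U [UU Uoo]] := exists_ultra_oo.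
have not_U A : ~ U A -> U (~` A) by have [] := in_ultra_setVsetC A UU.
have [u|F FP] := @choice _ _ (fun (u : bool * bool * nat) e =>
    U [set j | d (V u.1.1 u.2) (V u.1.2 j) = e]).
  apply: (@ultra_bounded U UU _ (M (V u.1.1 u.2))).
  by apply: filterS (ultra_gt Uoo u.2) => j /= uj; apply: dM; apply: VV.
pose f b b' i := F (b, b', i).
have {}FP b b' i : U [set j | d (V b i) (V b' j) = f b b' i].
  exact: FP (b, b', i).
have [[b nonconst]|diag] :=
    pselect (exists b, forall e, ~ U [set i | f b b i = e]).
  have [||phi [_ incr phiR]] := @ultra_sequence U UU Uoo setT
    (fun x _ _ => [set n | d (V b x) (V b n) = f b b x] `&`
                  ~` [set n | f b b n = f b b x]).
  - exact: filterT.
  - move=> x _ _ _ _ _; apply: filterI; first exact: FP.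
    by apply: not_U; exact: nonconst.
  apply/seteqP; split=> // m _.
  apply: (@G_lexical m (V b \o phi) (f b b \o phi)) => i j ij _ /=.
    by split; [apply: VV; exact: incr|have [] := phiR i i i j ij ij ij].
  by have [_ /eqP] := phiR i i i j ij ij ij; rewrite eq_sym.
have {}diag b : exists e, U [set i | f b b i = e].
  by apply: contrapT => nb; apply: diag; exists b => e Ue; apply: nb; exists e.
have [g gP] := choice diag.
(* Same-side limits are now constant; a varying mixed limit can be kept away from both constants, as
   [G_bipartite] requires. *)
have [[b nonconst]|anti] :=
    pselect (exists b, forall e, ~ U [set i | f b (~~ b) i = e]).
  have [||phi [phiW incr phiR]] := @ultra_sequence U UU Uoo
    ([set i | f b b i = g b] `&` [set i | f (~~ b) (~~ b) i = g (~~ b)] `&`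
      (~` [set i | f b (~~ b) i = g b] `&`
       ~` [set i | f b (~~ b) i = g (~~ b)]))
    (fun x _ _ => [set n | d (V b x) (V b n) = f b b x] `&`
      [set n | d (V (~~ b) x) (V (~~ b) n) = f (~~ b) (~~ b) x] `&`
      ([set n | d (V b x) (V (~~ b) n) = f b (~~ b) x] `&`
      ~` [set n | f b (~~ b) n = f b (~~ b) x])).
  - apply: filterI; first exact: filterI.
    by apply: filterI; apply: not_U; exact: nonconst.
  - move=> x _ _ _ _ _; apply: filterI; first by apply: filterI; exact: FP.
    by apply: filterI; [exact: FP|apply: not_U; exact: nonconst].
  apply: (@G_bipartite (V b \o phi) (V (~~ b) \o phi) (f b (~~ b) \o phi)
    (g b) (g (~~ b))).
  - by move=> i j /incr ij; split; apply: VV.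
  - move=> i j ij; have [[d1 d2] [d3 _]] := phiR i i i j ij ij ij.
    have [[<- <-] _] := phiW i; by split.
  - by move=> i; have [_ [/eqP n1 /eqP n2]] := phiW i.
  - by move=> i j ij; have [_ [_ /eqP]] := phiR i i i j ij ij ij; rewrite eq_sym.
have {}anti b : exists e, U [set i | f b (~~ b) i = e].
  by apply: contrapT => nb; apply: anti; exists b => e Ue; apply: nb; exists e.
have [g' g'P] := choice anti.
pose L b b' := if b == b' then g b else g' b.
have fL b b' : U [set i | f b b' i = L b b'].
  rewrite /L; case: eqP => [<-|/eqP]; first exact: gP.
  by case: b b' => [] [] //.
have U_bool (A : bool -> bool -> set nat) :
    (forall b b', U (A b b')) -> U [set n | forall b b', A b b' n].
  move=> UA.
  have U2 b : U [set n | forall b', A b b' n].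
    by apply: filterS2 (UA b true) (UA b false) => n At Af [].
  by apply: filterS2 (U2 true) (U2 false) => n At Af [].
have [||phi [phiW incr phiR]] := @ultra_sequence U UU Uoo
    [set i | forall b b', f b b' i = L b b']
    (fun x _ _ => [set n | forall b b', d (V b x) (V b' n) = f b b' x]).
- exact: U_bool.
- by move=> x _ _ _ _ _; apply: U_bool => b b'; exact: FP.
have VL b b' i j : i < j -> d (V b (phi i)) (V b' (phi j)) = L b b'.
  by move=> ij; rewrite -(phiW i) -(phiR i i i j).
(* The shift reserves [phi 0] as an earlier index: each [L b b'] is the colour of an edge from there
   to pair [phi i.+1], hence below its [c], even for [i = 0]. *)
apply: (@G_matching (fun b n => V b (phi n.+1)) L (fun n => c (phi n.+1))).
- by move=> b b' i j ij; rewrite VL //; split=> //; apply: VV; apply: incr.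
- by move=> i; split.
- move=> b b' i; rewrite -(VL b b' 0 i.+1) //.
  by apply: leq_ltn_trans (dVK _ _ _ _ _) (cK _); apply: incr.
- by move=> i j ij; apply: c_incr; apply: incr.
Qed.
End Colouring.

(** * Dichotomy on the colours at a single vertex *)

Theorem theorem2 (Delta : edge -> nat) (HDelta : infinite_set (range Delta)) :
  [\/ G_ Delta = [set: nat],
      exists X : set nat, infinite_set X /\ rainbow_coloured Delta X
    | exists X : set nat, infinite_set X /\ star_coloured Delta X].
Proof.
have [bounded|] := pselect (forall x, exists N, forall y, x != y ->
    pair_colour Delta x y <= N).
  have [M MP] := choice bounded.
  apply: Or31; apply: (@G_locally_bounded Delta M) => // N.
  apply: contrapT => nN; apply: HDelta.
  apply: sub_finite_set (finite_II N.+1) => _ [e _ <-] /=.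
  have [x [y [xy exy]]] := edgeP e.
  rewrite (pair_colourE Delta exy) ltnS leqNgt; apply/negP => Nxy.
  by apply: nN; exists x, y.
move=> /existsNP[v /forallNP vP].
have [N|h hP] := @choice _ _ (fun N y => v != y /\ N < pair_colour Delta v y).
  have /existsNP[y /not_implyP[vy /negP]] := vP N.
  by rewrite -ltnNge => Ny; exists y.
pose a := fix a n := if n is n'.+1 then h (pair_colour Delta v (a n')) else h 0.
have av n : v != a n.
  case: n => [|n]; first by have [] := hP 0.
  by have [] := hP (pair_colour Delta v (a n)).
have a_incr i j :
    i < j -> pair_colour Delta v (a i) < pair_colour Delta v (a j).
  elim: j => // j IH; have [_ lt_j] := hP (pair_colour Delta v (a j)).
  by rewrite ltnS leq_eqVlt => /predU1P[->//|/IH/ltn_trans]; apply.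
have a_inj i j : i < j -> a i != a j.
  by move=> /a_incr; apply: contraTneq => ->; rewrite ltnn.
have [?|?|[phi [c [incr mono]]]] := canonical_sequence Delta a_inj.
- exact: Or31.
- exact: Or32.
(* Colours at [v] increase strictly, so the [n]-th is at least [n]; dropping [c + 1] terms puts all
   of them above [c]. *)
pose b n := a (phi (c.+1 + n)).
have b_incr i j :
    i < j -> pair_colour Delta v (b i) < pair_colour Delta v (b j).
  by move=> ij; apply: a_incr; apply: incr; rewrite ltn_add2l.
have ge_n n : n <= pair_colour Delta v (a (phi n)).
  by elim: n => // n; move/leq_ltn_trans; apply; apply: a_incr; apply: incr.
apply: Or33; apply: (@star_of_sequence Delta v c b) => //.
- by move=> n; exact: av.
- by move=> n; exact: leq_trans (leq_addr n c.+1) (ge_n _).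
- by move=> i j ij; apply: mono; rewrite ltn_add2l.
Qed.
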